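(* Let $\kappa > 0$ and suppose $S \subset \mathbb{R}^D$ is compact, that the intrinsic topology (induced by $\delta_S$) and the ambient Euclidean topology coincide on $S$, and that the shortest paths on $S$ have curvature bounded by $\kappa$. Let $c_0 = \pi^2/50$ and let $\tau > 0$ be such that, for all $x,x' \in S$ with $\|x - x'\| \le \tau$, $$\|x - x'\| \le \delta_S(x,x') \le \|x - x'\| \min\big(\tfrac{\pi}{2},\ 1 + c_0 \kappa^2 \|x - x'\|^2\big)$$ (such a $\tau$, depending on $S$, exists). Consider a finite sample $\mathcal{X} = \{x_1,\dots,x_N\} \subset S$ and, for $r > 0$, form the corresponding $r$-ball graph. When $r \le \tau$ and $\kappa r \le 1/3$, we have $$\delta_S(x,x') \le (1 + c_0 \kappa^2 r^2)\, \Delta_r(x,x'), \qquad \forall x,x' \in \mathcal{X}.$$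
   Context: Intrinsic metric: for $x,x' \in S$, $\delta_S(x,x') = \inf\{a : \exists\, \gamma : [0,a] \to S \text{ 1-Lipschitz with } \gamma(0) = x,\ \gamma(a) = x'\}$ (equal to $\infty$ if there is no such $\gamma$). A shortest path on $S$ joining $x,x'$ is a unit-speed curve in $S$ joining $x$ and $x'$ of length $\delta_S(x,x') < \infty$. A unit-speed curve has curvature bounded by $\kappa$ if it is differentiable and its derivative is $\kappa$-Lipschitz. $r$-ball graph: the weighted graph on $\{1,\dots,N\}$ with $i \sim j$ if and only if $\|x_i - x_j\| \le r$, and edge weight $w_r(i,j) = \|x_i - x_j\|$ if $i \sim j$, $w_r(i,j) = \infty$ otherwise. For sample points, $\Delta_r(x_i,x_j) = \min\{\sum_{l=1}^{m-1} w_r(k_l,k_{l+1}) : m \ge 1, k_1 = i, k_m = j\}$ is the shortest-path distance between $i$ and $j$ in this graph (possibly $\infty$). *)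

(* Defs.v *)
From HB Require Import structures.
From mathcomp Require Import all_boot all_order all_algebra.
From mathcomp Require Import all_classical all_reals all_analysis.
Set Implicit Arguments.
Unset Strict Implicit.
Unset Printing Implicit Defensive.
Import Order.TTheory GRing.Theory Num.Theory.
Import numFieldNormedType.Exports.
Local Open Scope classical_set_scope.
Local Open Scope ring_scope.

(* The library's norm on row vectors is the sup norm, hence this definition.
   Both norms induce the same topology, so the library's [compact], [open] and
   convergence on ['rV[R]_D] are the Euclidean ones. *)
Definition enorm (R : realType) (D : nat) (v : 'rV[R]_D) : R :=
  Num.sqrt (\sum_(i < D) v ord0 i ^+ 2).

(* A curve [0, a] -> S is a function on all of R, of which only the
   restriction to [0, a] is ever used. *)
Definition maps_into (R : realType) (D : nat) (S : set 'rV[R]_D) (a : R)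
    (g : R -> 'rV[R]_D) : Prop :=
  forall t : R, t \in `[0, a] -> S (g t).

Definition elipschitz (R : realType) (D : nat) (k a : R)
    (g : R -> 'rV[R]_D) : Prop :=
  forall s t : R, s \in `[0, a] -> t \in `[0, a] ->
    enorm (g s - g t) <= k * `|s - t|.

Definition intrinsic_dist (R : realType) (D : nat) (S : set 'rV[R]_D)
    (x x' : 'rV[R]_D) : \bar R :=
  ereal_inf [set a%:E | a in [set a : R | 0 <= a /\
    exists g : R -> 'rV[R]_D,
      [/\ maps_into S a g, elipschitz 1 a g, g 0 = x & g a = x']]].

Definition intrinsic_open (R : realType) (D : nat) (S U : set 'rV[R]_D) : Prop :=
  U `<=` S /\
  forall x, U x -> exists2 e : R, 0 < e &
    forall y, S y -> (intrinsic_dist S x y < e%:E)%E -> U y.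

Definition ambient_open (R : realType) (D : nat) (S U : set 'rV[R]_D) : Prop :=
  exists2 V : set 'rV[R]_D, open V & U = V `&` S.

Definition same_topology (R : realType) (D : nat) (S : set 'rV[R]_D) : Prop :=
  forall U : set 'rV[R]_D, intrinsic_open S U <-> ambient_open S U.

(* The library's [total_variation], for vector-valued functions and the
   Euclidean norm. *)
Definition curve_length (R : realType) (D : nat) (g : R -> 'rV[R]_D)
    (s t : R) : \bar R :=
  ereal_sup [set (\sum_(0 <= n < size l)
      enorm (g (nth t l n) - g (nth t (s :: l) n)))%:E
    | l in itv_partition s t].

(* Parametrization by arc length; no differentiability is presupposed. *)
Definition unit_speed (R : realType) (D : nat) (a : R)
    (g : R -> 'rV[R]_D) : Prop :=
  forall s t : R, 0 <= s -> s <= t -> t <= a -> curve_length g s t = (t - s)%:E.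

Definition shortest_path (R : realType) (D : nat) (S : set 'rV[R]_D)
    (x x' : 'rV[R]_D) (a : R) (g : R -> 'rV[R]_D) : Prop :=
  [/\ 0 <= a, maps_into S a g, unit_speed a g, g 0 = x & g a = x'] /\
  curve_length g 0 a = intrinsic_dist S x x' /\
  (intrinsic_dist S x x' < +oo)%E.

(* The limit is taken within [0, a], so it is one-sided at the endpoints. *)
Definition derivative_on (R : realType) (D : nat) (a : R)
    (g dg : R -> 'rV[R]_D) : Prop :=
  forall t : R, t \in `[0, a] ->
    (s - t)^-1 *: (g s - g t) @[s --> within [set` `[0, a]] t^'] --> dg t.

Definition curvature_bounded (R : realType) (D : nat) (kappa a : R)
    (g : R -> 'rV[R]_D) : Prop :=
  exists2 dg : R -> 'rV[R]_D, derivative_on a g dg & elipschitz kappa a dg.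

Definition c0 (R : realType) : R := pi ^+ 2 / 50.
Arguments c0 {R}.

Definition metric_comparison (R : realType) (D : nat) (S : set 'rV[R]_D)
    (kappa tau : R) : Prop :=
  forall x x', S x -> S x' -> enorm (x - x') <= tau ->
    ((enorm (x - x'))%:E <= intrinsic_dist S x x')%E /\
    (intrinsic_dist S x x' <=
      (enorm (x - x') *
       Num.min (pi / 2) (1 + c0 * kappa ^+ 2 * enorm (x - x') ^+ 2))%:E)%E.

Definition ball_graph_weight (R : realType) (D N : nat) (x : 'I_N -> 'rV[R]_D)
    (r : R) (i j : 'I_N) : \bar R :=
  if enorm (x i - x j) <= r then (enorm (x i - x j))%:E else +oo%E.

(* The walk k_1, ..., k_m is a function on nat used only at 1, ..., m.  The
   infimum is a minimum: only the finitely many walks without repeated vertices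
   matter. *)
Definition graph_dist (R : realType) (D N : nat) (x : 'I_N -> 'rV[R]_D)
    (r : R) (i j : 'I_N) : \bar R :=
  ereal_inf [set d | exists m (k : nat -> 'I_N),
    [/\ (1 <= m)%N, k 1%N = i, k m = j &
      d = (\sum_(1 <= l < m) ball_graph_weight x r (k l) (k l.+1))%E]].

(* Main.v *)
Require Import Defs.
From mathcomp Require Import all_boot all_order all_algebra ring lra.
From mathcomp Require Import all_classical all_reals all_analysis.
Import Order.TTheory GRing.Theory Num.Theory.
Import numFieldNormedType.Exports.
Local Open Scope classical_set_scope.
Local Open Scope ring_scope.

(* A walk in the graph is bounded edge by edge: every edge has length at most
   [r <= tau], so the comparison inequality applies to it, and the triangle
   inequality for the intrinsic distance sums the bounds.

   For the existence of [tau]: two points at finite intrinsic distance [a] are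
   joined by a curve of duration exactly [a] (compactness), and this curve has
   unit speed, since otherwise its reparametrization by arc length would be
   faster.  By the curvature bound its velocity turns by at most
   [kappa |s - a / 2|] from the midpoint velocity; integrating gives
   [|x - x'| >= a - kappa^2 a^3 / 24].  As [1 / 24 < pi^2 / 50] this inverts to
   the claimed bound once [kappa a] is small, and [a] is uniformly small when
   [|x - x'|] is, because the two topologies coincide on the compact set [S]. *)

Set Implicit Arguments.
Unset Strict Implicit.
Unset Printing Implicit Defensive.

(** * Euclidean norm *)

Section Euclid.
Variables (R : realType) (D : nat).
Implicit Types (u v w : 'rV[R]_D) (c : R).

Definition edot u v : R := \sum_(i < D) u ord0 i * v ord0 i.

Lemma edotC u v : edot u v = edot v u.
Proof. by apply: eq_bigr => i _; rewrite mulrC. Qed.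

Lemma edotDl u w v : edot (u + w) v = edot u v + edot w v.
Proof. by rewrite -big_split; apply: eq_bigr => i _; rewrite !mxE mulrDl. Qed.

Lemma edotZl c u v : edot (c *: u) v = c * edot u v.
Proof. by rewrite mulr_sumr; apply: eq_bigr => i _; rewrite !mxE mulrA. Qed.

Lemma edotZr c u v : edot u (c *: v) = c * edot u v.
Proof. by rewrite edotC edotZl edotC. Qed.

Lemma edotNl u v : edot (- u) v = - edot u v.
Proof. by rewrite -scaleN1r edotZl mulN1r. Qed.

Lemma edotBl u w v : edot (u - w) v = edot u v - edot w v.
Proof. by rewrite edotDl edotNl. Qed.

Lemma edotBr u w v : edot v (u - w) = edot v u - edot v w.
Proof. by rewrite edotC edotBl !(edotC v). Qed.

Lemma edotDr u w v : edot v (u + w) = edot v u + edot v w.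
Proof. by rewrite edotC edotDl !(edotC v). Qed.

Lemma edot_ge0 u : 0 <= edot u u.
Proof. by apply: sumr_ge0 => i _; rewrite -expr2 sqr_ge0. Qed.

Lemma enorm_ge0 u : 0 <= enorm u.
Proof. exact: sqrtr_ge0. Qed.

Lemma enorm_sqr u : enorm u ^+ 2 = edot u u.
Proof.
by rewrite sqr_sqrtr; [apply: eq_bigr|apply: sumr_ge0] => i _; rewrite ?expr2// -expr2 sqr_ge0.
Qed.

Lemma enorm0 : enorm (0 : 'rV[R]_D) = 0.
Proof.
by rewrite /enorm big1 ?sqrtr0// => i _; rewrite mxE expr0n.
Qed.

Lemma enorm_eq0 u : enorm u = 0 -> u = 0.
Proof.
move=> u0; apply/rowP => i; rewrite mxE; apply/eqP; rewrite -sqrf_eq0 eq_le sqr_ge0 andbT.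
have : edot u u = 0 by rewrite -enorm_sqr u0 expr0n.
rewrite /edot (bigD1 i)//= => H.
have : 0 <= \sum_(j < D | j != i) u ord0 j * u ord0 j.
  by apply: sumr_ge0 => j _; rewrite -expr2 sqr_ge0.
by rewrite (ord1 0) expr2; lra.
Qed.

(* Positivity of [edot] at [|v| u - |u| v]. *)
Lemma edot_le_enorm u v : edot u v <= enorm u * enorm v.
Proof.
have [/enorm_eq0 ->|u0] := eqVneq (enorm u) 0.
  by rewrite -(scale0r 0) edotZl mul0r mulr_ge0 ?enorm_ge0.
have [/enorm_eq0 ->|v0] := eqVneq (enorm v) 0.
  by rewrite edotC -(scale0r 0) edotZl mul0r mulr_ge0 ?enorm_ge0.
have {u0} u0 : 0 < enorm u by rewrite lt_neqAle eq_sym u0 enorm_ge0.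
have {v0} v0 : 0 < enorm v by rewrite lt_neqAle eq_sym v0 enorm_ge0.
have := edot_ge0 (enorm v *: u - enorm u *: v).
rewrite edotBr !edotBl !(edotZl, edotZr) -!enorm_sqr (edotC v u) => H.
have : 0 <= (enorm u * enorm v) * (enorm u * enorm v - edot u v) by nra.
by rewrite pmulr_rge0 ?mulr_gt0// subr_ge0.
Qed.

Lemma enormN u : enorm (- u) = enorm u.
Proof. by congr Num.sqrt; apply: eq_bigr => i _; rewrite mxE sqrrN. Qed.

Lemma enormC u v : enorm (u - v) = enorm (v - u).
Proof. by rewrite -enormN opprB. Qed.

Lemma enormD u v : enorm (u + v) <= enorm u + enorm v.
Proof.
rewrite -(@ler_pXn2r _ 2) ?nnegrE ?addr_ge0 ?enorm_ge0//.
rewrite enorm_sqr edotDr !edotDl -!enorm_sqr (edotC v u).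
have := edot_le_enorm u v; nra.
Qed.

Lemma enorm_triangle w u v : enorm (u - v) <= enorm (u - w) + enorm (w - v).
Proof. by rewrite -[u - v](subrKA w) enormD. Qed.

Lemma enormZ c u : enorm (c *: u) = `|c| * enorm u.
Proof.
rewrite /enorm -sqrtr_sqr -sqrtrM ?sqr_ge0// mulr_sumr.
by congr Num.sqrt; apply: eq_bigr => i _; rewrite mxE exprMn.
Qed.

Lemma edot_abs_le u v : `|edot u v| <= enorm u * enorm v.
Proof.
rewrite ler_norml edot_le_enorm andbT lerNl -edotNl.
by rewrite -(enormN u) edot_le_enorm.
Qed.

Lemma coord_le_enorm u i : `|u ord0 i| <= enorm u.
Proof.
rewrite -(@ler_pXn2r _ 2) ?nnegrE ?enorm_ge0// real_normK ?num_real// enorm_sqr /edot.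
rewrite (bigD1 i)//= expr2 lerDl.
by apply: sumr_ge0 => j _; rewrite -expr2 sqr_ge0.
Qed.

Lemma mx_norm_le_enorm u : `|u| <= enorm u.
Proof.
rewrite {1}/Num.norm/= mx_normrE; apply: bigmax_le; first exact: enorm_ge0.
by move=> [i j] _ /=; rewrite (ord1 i) coord_le_enorm.
Qed.

(** The constant [D] is cruder than its square root, but any constant suffices for comparing the two
    topologies. *)
Lemma enorm_le_mx_norm u : enorm u <= D%:R * `|u|.
Proof.
have le_coord i : `|u ord0 i| <= `|u|.
  rewrite [leRHS]/Num.norm/= mx_normrE.
  exact: (le_bigmax _ (fun ij : 'I_1 * 'I_D => `|u ij.1 ij.2|) (ord0, i)).
rewrite -(@ler_pXn2r _ 2) ?nnegrE ?mulr_ge0 ?enorm_ge0//.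
rewrite enorm_sqr.
apply: (@le_trans _ _ (\sum_(i < D) `|u| ^+ 2)).
  apply: ler_sum => i _; rewrite -expr2 -real_normK ?num_real//.
  by rewrite ler_pXn2r ?nnegrE//.
rewrite sumr_const card_ord exprMn -[_ *+ D]mulr_natl.
apply: ler_wpM2r; first exact: exprn_ge0.
by rewrite -natrX ler_nat; case: (D) => // n; rewrite expnS leq_pmulr.
Qed.

End Euclid.

(** * Curves joining two points *)

Section Clamp.
Variable R : realType.
Implicit Types a b s t : R.

(** Retraction of the line onto [a, b]. Composing a curve with it gives a function on the whole line
    with the same Lipschitz constant, to which theorems on continuous functions apply. *)
Definition clamp a b t := Num.max a (Num.min t b).

Lemma clamp_itv a b t : a <= b -> a <= clamp a b t <= b.
Proof.
move=> ab; rewrite /clamp.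
by case: (leP t b) => tb; [case: (leP a t)|case: (leP a b)] => ?; apply/andP; split; lra.
Qed.

Lemma clamp_id a b t : a <= t -> t <= b -> clamp a b t = t.
Proof. by move=> at_ tb; rewrite /clamp (min_l tb) (max_r at_). Qed.

Lemma clamp_ge a b t : a <= b -> b <= t -> clamp a b t = b.
Proof. by move=> ab bt; rewrite /clamp (min_r bt) (max_r ab). Qed.

Lemma clamp_dist a b s t : a <= b -> s <= t ->
  clamp a b s <= clamp a b t /\ clamp a b t - clamp a b s <= t - s.
Proof.
rewrite /clamp => ab st.
by case: (leP s b) => ?; case: (leP t b) => ?; case: (leP a s) => ?;
  case: (leP a t) => ?; case: (leP a b) => ?; split; lra.
Qed.

End Clamp.

(** * Reversal and concatenation of 1-Lipschitz curves *)

Section Reach.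
Variables (R : realType) (D : nat).
Implicit Types (S : set 'rV[R]_D) (g : R -> 'rV[R]_D) (a b s t k : R) (x y : 'rV[R]_D).

(** Restricting to ordered pairs avoids absolute values, and a free left endpoint allows passage to
    subintervals. *)
Definition lip_on k s t g := forall u v, s <= u -> u <= v -> v <= t ->
  enorm (g u - g v) <= k * (v - u).

Lemma elipschitzE k a g : elipschitz k a g <-> lip_on k 0 a g.
Proof.
split=> [H u v u0 uv va|H s t].
  by have := H u v; rewrite !in_itv/= distrC ger0_norm ?subr_ge0//; apply; lra.
rewrite !in_itv/= => /andP[s0 sa] /andP[t0 ta].
case: (leP s t) => st.
  by rewrite distrC (ger0_norm (_ : 0 <= t - s)) ?subr_ge0//; exact: (H s t).
have {}st := ltW st.
by rewrite enormC (ger0_norm (_ : 0 <= s - t)) ?subr_ge0//; exact: (H t s).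
Qed.

(** Membership of [a] in the set whose infimum is [intrinsic_dist S x y]. *)
Definition reach S a x y := 0 <= a /\ exists g : R -> 'rV[R]_D,
  [/\ maps_into S a g, elipschitz 1 a g, g 0 = x & g a = y].

Lemma intrinsic_dist_le S a x y : reach S a x y -> (intrinsic_dist S x y <= a%:E)%E.
Proof. by move=> H; apply: ereal_inf_lbound; exists a. Qed.

Lemma intrinsic_dist_lt S x y (e : \bar R) : (intrinsic_dist S x y < e)%E ->
  exists2 a, reach S a x y & (a%:E < e)%E.
Proof. by move=> /ereal_inf_lt[_ [a Ha <-] ae]; exists a. Qed.

Lemma le_intrinsic_dist S x y (e : \bar R) :
  (forall a, reach S a x y -> (e <= a%:E)%E) -> (e <= intrinsic_dist S x y)%E.
Proof. by move=> H; apply: le_ereal_inf_tmp => _ [a Ha <-]; exact: H. Qed.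

Lemma intrinsic_dist_ge0 S x y : (0 <= intrinsic_dist S x y)%E.
Proof. by apply: le_intrinsic_dist => a [a0 _]; rewrite lee_fin. Qed.

Lemma enorm_le_reach S a x y : reach S a x y -> enorm (x - y) <= a.
Proof.
move=> [a0 [g [_ /elipschitzE gL <- <-]]].
by have := gL 0 a (lexx _) a0 (lexx _); rewrite mul1r subr0.
Qed.

Lemma reach_refl S x : S x -> reach S 0 x x.
Proof.
move=> Sx; split => //; exists (fun=> x); split => //.
by move=> s t _ _; rewrite subrr enorm0 mulr_ge0.
Qed.

Lemma reach_sym S a x y : reach S a x y -> reach S a y x.
Proof.
move=> [a0 [g [gS /elipschitzE gL <- <-]]]; split => //.
exists (fun t => g (a - t)); split; rewrite ?subr0 ?subrr//.
  by move=> t; rewrite in_itv/= => ta; apply: gS; rewrite in_itv/=; apply/andP; split; lra.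
apply/elipschitzE => u v u0 uv va.
rewrite enormC; have := gL (a - v) (a - u).
have -> : a - u - (a - v) = v - u by ring.
by apply; lra.
Qed.

(* A curve of duration [a] can be extended to the whole line by rest at its
   endpoints. *)
Lemma reach_line S a x y : reach S a x y -> exists g : R -> 'rV[R]_D,
  [/\ forall t, S (g t), forall s t, s <= t -> enorm (g s - g t) <= t - s,
      g 0 = x & forall t, a <= t -> g t = y].
Proof.
move=> [a0 [g [gS /elipschitzE gL <- <-]]].
exists (fun t => g (clamp 0 a t)); split.
- by move=> t; apply: gS; rewrite in_itv/= clamp_itv.
- move=> s t st; have [H1 H2] := clamp_dist a0 st.
  have := @clamp_itv _ 0 a s a0; have := @clamp_itv _ 0 a t a0.
  move=> /andP[? ?] /andP[? ?].
  by apply: le_trans H2; rewrite -[leRHS]mul1r; apply: (gL (clamp 0 a s)).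
- by rewrite clamp_id.
- by move=> t ta; rewrite clamp_ge.
Qed.

Lemma reach_of_line S a x y g : 0 <= a -> (forall t, S (g t)) ->
  (forall s t, s <= t -> enorm (g s - g t) <= t - s) ->
  g 0 = x -> g a = y -> reach S a x y.
Proof.
move=> a0 gS gL gx gy; split => //; exists g; split=> //.
by apply/elipschitzE => u v _ uv _; rewrite mul1r; apply: gL.
Qed.

Lemma reach_mono S a b x y : a <= b -> reach S a x y -> reach S b x y.
Proof.
move=> ab H; have [a0 _] := H.
have [g [gS gL g0 gy]] := reach_line H.
by apply: (reach_of_line (g := g)) => //; [exact: le_trans ab|exact: gy].
Qed.

Lemma reach_trans S a b x y z : reach S a x y -> reach S b y z -> reach S (a + b) x z.
Proof.
move=> H1 H2; have [a0 _] := H1; have [b0 _] := H2.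
have [g [gS gL g0 gy]] := reach_line H1.
have [h [hS hL h0 hz]] := reach_line H2.
apply: (reach_of_line (g := fun t => if t <= a then g t else h (t - a))).
- exact: addr_ge0.
- by move=> t; case: ifP.
- move=> s t st; case: (leP s a) => sa; case: (leP t a) => ta.
  + exact: gL.
  (* Both curves are at [y] at the switching time [a], so a chord across it splits there. *)
  + apply: (le_trans (enorm_triangle y _ _)).
    rewrite -{1}(gy a)// -h0; have := gL s a sa; have := @hL 0 (t - a); lra.
  + lra.
  + have := @hL (s - a) (t - a); have -> : t - a - (s - a) = t - s by ring.
    by apply; lra.
- by rewrite a0.
(* The first curve is still in use at time [a + b] only if [b = 0], and then [y = z]. *)
- case: leP => [ba|_]; last by apply: hz; lra.
  rewrite gy ?lerDl// -(hz b)//; have -> : b = 0 by lra.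
  by rewrite h0.
Qed.

(** Curves within [e / 2] of each infimum are concatenated, after infinite terms have been set
    aside. *)
Lemma intrinsic_dist_triangle S x y z :
  (intrinsic_dist S x z <= intrinsic_dist S x y + intrinsic_dist S y z)%E.
Proof.
have [->|xy] := eqVneq (intrinsic_dist S x y) +oo%E.
  by rewrite addye ?leey// gt_eqF// (lt_le_trans _ (intrinsic_dist_ge0 _ _ _)).
have [->|yz] := eqVneq (intrinsic_dist S y z) +oo%E.
  by rewrite addey ?leey// gt_eqF// (lt_le_trans _ (intrinsic_dist_ge0 _ _ _)).
have fin u v : intrinsic_dist S u v != +oo%E -> intrinsic_dist S u v \is a fin_num.
  by move=> H; rewrite ge0_fin_numE ?intrinsic_dist_ge0// ltey.
rewrite -(fineK (fin _ _ xy)) -(fineK (fin _ _ yz)).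
apply/lee_addgt0Pr => e e0.
have lt_half u v : intrinsic_dist S u v != +oo%E ->
    exists2 a, reach S a u v & a < fine (intrinsic_dist S u v) + e / 2.
  move=> /fin H; have := @intrinsic_dist_lt S u v (fine (intrinsic_dist S u v) + e / 2)%:E.
  rewrite -{1}(fineK H) lte_fin ltrDl divr_gt0// => /(_ isT)[a Ha]; rewrite lte_fin.
  by exists a.
have [a Ha alt] := lt_half _ _ xy; have [b Hb blt] := lt_half _ _ yz.
apply: (le_trans (intrinsic_dist_le (reach_trans Ha Hb))).
by rewrite -!EFinD lee_fin; lra.
Qed.

End Reach.

(** * Compactness: a finite intrinsic distance is attained *)

Section Closed.
Variables (R : realType) (D : nat).
Implicit Types (S : set 'rV[R]_D) (g : R -> 'rV[R]_D) (a b s t k e : R) (x y : 'rV[R]_D).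

Lemma nbhs_enorm x e : 0 < e -> nbhs x [set v | enorm (v - x) < e].
Proof.
move=> e0; have D0 : 0 < D.+1%:R :> R by [].
apply/nbhs_ballP; exists (e / D.+1%:R) => /=; first exact: divr_gt0.
move=> v; rewrite -ball_normE /= ltr_pdivlMr// mulrC => H.
rewrite enormC; apply: le_lt_trans H; apply: (le_trans (enorm_le_mx_norm _)).
by apply: ler_wpM2r => //; rewrite ler_nat.
Qed.

Lemma enorm_small x y : (forall e, 0 < e -> enorm (x - y) <= e) -> x = y.
Proof.
move=> H; apply/eqP; rewrite -subr_eq0; apply/eqP/enorm_eq0/eqP.
rewrite eq_le enorm_ge0 andbT; apply/ler_addgt0Pr => e e0; rewrite add0r; exact: H.
Qed.

(* By Tychonoff the curves realizing [a + e] accumulate pointwise as [e] goes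
   to [0], and the pointwise limit inherits the Lipschitz bound. *)
Lemma reach_closed S a x y : compact S -> 0 <= a ->
  (forall e, 0 < e -> reach S (a + e) x y) -> reach S a x y.
Proof.
move=> cS a0 H.
have [G HG] : exists G : R -> (R -> 'rV[R]_D), forall e, 0 < e ->
   [/\ forall t, S (G e t), forall s t, s <= t -> enorm (G e s - G e t) <= t - s,
      G e 0 = x & forall t, a + e <= t -> G e t = y].
  suff /choice[G HG] : forall e, exists g, 0 < e ->
   [/\ forall t, S (g t), forall s t, s <= t -> enorm (g s - g t) <= t - s,
      g 0 = x & forall t, a + e <= t -> g t = y] by exists G.
  move=> e; have [e0|e0] := ltP 0 e; last by exists (fun=> x).
  by have [g Hg] := reach_line (H e e0); exists g.
pose T := prod_topology (fun _ : R => 'rV[R]_D).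
pose K : set T := [set f : T | forall t, S (f t)].
have cK : compact K by exact: (@tychonoff R (fun=> 'rV[R]_D) (fun=> S)).
pose F : set_system T := (G : R -> T) @ 0^'+.
have FF : ProperFilter F by exact: fmap_proper_filter.
have FK : F K.
  rewrite /F /fmap /=; near=> e => t.
  by have [|+ _ _ _] := HG e; [near: e; exact: nbhs_right_gt|exact].
have [g [gS gF]] := cK F FF FK.
(* A neighbourhood in the product topology controls finitely many times. Two are enough, because the
   Lipschitz condition compares two values. *)
have approx s t e : 0 < e -> exists c, [/\ 0 < c, c < e,
    enorm (G c s - g s) < e & enorm (G c t - g t) < e].
  move=> e0.
  pose U := [set h : T | exists2 c, 0 < c < e & h = G c].
  have FU : F U.
    rewrite /F /fmap /=; near=> c; exists c => //; apply/andP; split.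
      by near: c; exact: nbhs_right_gt.
    by near: c; exact: nbhs_right_lt.
  pose V u := [set h : T | enorm (h u - g u) < e].
  have nV u : nbhs (g : T) (V u).
    exact: (@proj_continuous R (fun=> 'rV[R]_D) u g _ (nbhs_enorm (g u) e0)).
  have [h [[c /andP[c0 ce] ->] [Vs Vt]]] := gF U _ FU (filterI (nV s) (nV t)).
  by exists c.
apply: (reach_of_line (g := g)) => //.
- move=> s t st; apply/ler_addgt0Pr => e e0.
  have [|c [c0 ce gs gt]] := approx s t (e / 2); first exact: divr_gt0.
  have [_ /(_ s t st) GL _ _] := HG c c0.
  have := enorm_triangle (G c s) (g s) (g t); have := enorm_triangle (G c t) (G c s) (g t).
  rewrite (enormC (g s) (G c s)); lra.
- apply/enorm_small => e e0; have [c [c0 _ + _]] := approx 0 0 e e0.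
  by have [_ _ -> _] := HG c c0; rewrite enormC => /ltW.
(* [G c] is only known to be at [y] from time [a + c] on, so at time [a] it is within [c < e / 2] of
   [y]. *)
- apply/enorm_small => e e0; have [|c [c0 ce + _]] := approx a a (e / 2).
    exact: divr_gt0.
  have [_ GL _ Gy] := HG c c0.
  have ac : a <= a + c by rewrite lerDl ltW.
  have := GL _ _ ac; rewrite (Gy (a + c))//.
  have := enorm_triangle (G c a) (g a) y; rewrite (enormC (g a) (G c a)); lra.
Unshelve. all: end_near. Qed.

Lemma reach_intrinsic_dist S a x y : compact S ->
  intrinsic_dist S x y = a%:E -> reach S a x y.
Proof.
move=> cS dE; apply: reach_closed => //.
  by rewrite -lee_fin -dE intrinsic_dist_ge0.
move=> e e0; have [|b Hb be] := @intrinsic_dist_lt _ _ S x y (a + e)%:E.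
  by rewrite dE lte_fin ltrDl.
by apply: reach_mono Hb; rewrite lte_fin in be; exact: ltW.
Qed.

End Closed.

(** * Length and shortest paths *)

Section Length.
Variables (R : realType) (D : nat).
Implicit Types (S : set 'rV[R]_D) (g : R -> 'rV[R]_D) (a b s t u v k e : R).
Implicit Types (x y : 'rV[R]_D) (l : seq R).

(** Recursive form of the sum in [curve_length], suited to induction on the partition. *)
Fixpoint polyline g s l : R :=
  if l is t :: l' then enorm (g t - g s) + polyline g t l' else 0.

Lemma polylineE g s d l :
  \sum_(0 <= n < size l) enorm (g (nth d l n) - g (nth d (s :: l) n)) = polyline g s l.
Proof.
elim: l s => [|t l IHl] s /=; first by rewrite big_geq.
by rewrite big_nat_recl//= IHl.
Qed.

Lemma curve_lengthE g s t :
  curve_length g s t = ereal_sup [set (polyline g s l)%:E | l in itv_partition s t].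
Proof. by congr ereal_sup; apply: eq_imagel => l _; rewrite polylineE. Qed.

Lemma polyline_rcons g s l t :
  polyline g s (rcons l t) = polyline g s l + enorm (g t - g (last s l)).
Proof. by elim: l s => [|u l IHl] s /=; rewrite ?add0r ?addr0// IHl addrA. Qed.

Lemma le_curve_length g s t l : itv_partition s t l ->
  ((polyline g s l)%:E <= curve_length g s t)%E.
Proof. by move=> H; rewrite curve_lengthE; apply: ereal_sup_ubound; exists l. Qed.

Lemma curve_length_le g s t (e : \bar R) :
  (forall l, itv_partition s t l -> ((polyline g s l)%:E <= e)%E) ->
  (curve_length g s t <= e)%E.
Proof.
by move=> H; rewrite curve_lengthE; apply: ge_ereal_sup => _ [l Hl <-]; exact: H.
Qed.

Lemma itv_partition_exists s t : s <= t -> exists l, itv_partition s t l.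
Proof.
rewrite le_eqVlt => /predU1P[->|st]; first by exists [::]; split=> //=.
by exists [:: t]; exact: itv_partition1.
Qed.

Lemma polyline_ge0 g s l : 0 <= polyline g s l.
Proof. by elim: l s => //= t l IHl s; rewrite addr_ge0 ?enorm_ge0. Qed.

Lemma curve_length_ge0 g s t : s <= t -> (0 <= curve_length g s t)%E.
Proof.
move=> /itv_partition_exists[l Hl]; apply: le_trans (le_curve_length g Hl).
by rewrite lee_fin polyline_ge0.
Qed.

Lemma polyline_lip k g s t l : lip_on k s t g -> itv_partition s t l ->
  polyline g s l <= k * (t - s).
Proof.
elim: l s => [|u l IHl] s gL /= H.
  by rewrite (itv_partition_nil H) subrr mulr0.
have [/= /andP[su _] _] := H.
have Hl := itv_partition_cons H; have ut := itv_partition_le Hl.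
have {}su := ltW su.
have gL' : lip_on k u t g by move=> p q up; apply: gL; exact: le_trans up.
have := IHl u gL' Hl; have := gL s u (lexx _) su ut; rewrite enormC; lra.
Qed.

Lemma curve_length_lip k g s t : lip_on k s t g ->
  (curve_length g s t <= (k * (t - s))%:E)%E.
Proof. by move=> gL; apply: curve_length_le => l Hl; rewrite lee_fin polyline_lip. Qed.

(** Appending [v] to a partition of [s, u] gives one of [s, v]. Partitions increase strictly, hence
    the separate case [u = v]. *)
Lemma curve_length_chord g s u v : u <= v ->
  (curve_length g s u + (enorm (g u - g v))%:E <= curve_length g s v)%E.
Proof.
rewrite le_eqVlt => /predU1P[->|uv]; first by rewrite subrr enorm0 adde0.
rewrite -leeBrDr//; apply: curve_length_le => l [sl /eqP lu].
rewrite leeBrDr// enormC -EFinD -lu -polyline_rcons.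
by apply: le_curve_length; split; rewrite ?last_rcons// rcons_path sl lu.
Qed.

(** The partition is truncated at [u], which becomes its last point; the Lipschitz bound pays for
    what is cut off, of duration [v - u]. *)
Lemma polyline_cut g s u v l : lip_on 1 s v g -> s <= u -> u <= v ->
  itv_partition s v l ->
  exists2 l', itv_partition s u l' & polyline g s l <= polyline g s l' + (v - u).
Proof.
elim: l s => [|t l IHl] s gL su uv Hl.
  have sv := itv_partition_nil Hl; have -> : u = s by lra.
  by exists [::]; rewrite //= -?sv ?subrr ?addr0//; split.
have [/= /andP[st _] _] := Hl.
have Hl' := itv_partition_cons Hl; have tv := itv_partition_le Hl'.
have gL' : lip_on 1 t v g.
  by move=> p q tp; apply: gL; exact: le_trans (ltW st) tp.
case: (leP t u) => tu.
  have [l' [tl' lu] le_l'] := IHl t gL' tu uv Hl'.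
  exists (t :: l') => /=; first by split => //=; rewrite st.
  by rewrite -addrA lerD2l.
have le_l := polyline_lip gL' Hl'.
have := gL u t su (ltW tu) tv; rewrite enormC => gut.
move: su; rewrite le_eqVlt => /predU1P[su|su].
  by exists [::]; [split; rewrite //= su|rewrite /= su; lra].
exists [:: u]; first exact: itv_partition1.
rewrite /=; have := enorm_triangle (g u) (g t) (g s); lra.
Qed.

(** With [curve_length_chord], this makes arc length monotone and 1-Lipschitz, hence continuous. *)
Lemma curve_length_lipD g s u v : lip_on 1 s v g -> s <= u -> u <= v ->
  (curve_length g s v <= curve_length g s u + (v - u)%:E)%E.
Proof.
move=> gL su uv; apply: curve_length_le => l Hl.
have [l' Hl' le_l'] := polyline_cut gL su uv Hl.
apply: (@le_trans _ _ (polyline g s l' + (v - u))%:E); first by rewrite lee_fin.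
by rewrite EFinD; apply: leeD2r; exact: le_curve_length.
Qed.

Lemma continuous_lip k (f : R -> R) :
  (forall s t, s <= t -> `|f t - f s| <= k * (t - s)) -> continuous f.
Proof.
move=> fL x; apply/cvgrPdist_lt => e e0; near=> t.
have k0 : 0 < `|k| + 1 by rewrite ltr_wpDl.
have : `|x - t| < e / (`|k| + 1) by near: t; apply: cvgr_dist_lt => //; exact: divr_gt0.
rewrite ltr_pdivlMr// mulrDr mulr1 => xte.
have kle := ler_norm k; have k0' := normr_ge0 k; have xt0 := normr_ge0 (x - t).
have : `|f x - f t| <= k * `|x - t|.
  case: (leP x t) => [xt|/ltW tx].
    by rewrite (distrC x) (distrC (f x)) (ger0_norm (_ : 0 <= t - x)) ?subr_ge0// fL.
  by rewrite (ger0_norm (_ : 0 <= x - t)) ?subr_ge0// fL.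
nra.
Unshelve. all: end_near. Qed.

(* Reparametrization by arc length. *)
Lemma reach_curve_length S g s t L : s <= t ->
  (forall u, s <= u -> u <= t -> S (g u)) -> lip_on 1 s t g ->
  curve_length g s t = L%:E -> reach S L (g s) (g t).
Proof.
move=> st gS gL Lst.
pose len u := fine (curve_length g s u).
have lenE u : s <= u -> u <= t -> curve_length g s u = (len u)%:E.
  move=> su ut; rewrite fineK// ge0_fin_numE ?curve_length_ge0//.
  apply: le_lt_trans (ltry (1 * (u - s))); apply: curve_length_lip.
  by move=> p q sp pq qu; apply: gL => //; exact: le_trans ut.
have lenL : len t = L by rewrite /len Lst.
have len_chord u v : s <= u -> u <= v -> v <= t -> enorm (g u - g v) <= len v - len u.
  move=> su uv vt; have := curve_length_chord g s uv.
  rewrite !lenE ?(le_trans uv)// ?(le_trans su)// -EFinD lee_fin; lra.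
have len_lip u v : s <= u -> u <= v -> v <= t -> len v - len u <= v - u.
  move=> su uv vt; have gLv : lip_on 1 s v g.
    by move=> p q sp pq qv; apply: gL => //; exact: le_trans vt.
  have := curve_length_lipD gLv su uv.
  rewrite !lenE ?(le_trans uv)// ?(le_trans su)// -EFinD lee_fin; lra.
have len_s : len s = 0.
  apply/eqP; rewrite eq_le -!lee_fin -lenE// curve_length_ge0// andbT.
  rewrite -(mulr0 1) -(subrr s); apply: curve_length_lip.
  by move=> p q sp pq qu; apply: gL => //; exact: le_trans st.
have L0 : 0 <= L by rewrite -lee_fin -Lst curve_length_ge0.
have len_mono u v : s <= u -> u <= v -> v <= t -> len u <= len v.
  by move=> su uv vt; rewrite -subr_ge0; apply: le_trans (len_chord _ _ su uv vt); exact: enorm_ge0.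
(* A right inverse [c] of arc length, by the intermediate value theorem. Where [len] is constant so
   is [g], by [len_chord], so any choice of preimage will do. *)
have /choice[c Hc] : forall w, exists u, 0 <= w <= L -> s <= u <= t /\ len u = w.
  move=> w; have [w0L|] := boolP (0 <= w <= L); last by exists 0.
  pose f u := len (clamp s t u).
  have fc : continuous f.
    apply: (@continuous_lip 1) => p q pq; have [Hm Hd] := clamp_dist st pq.
    have /andP[sp pt] := clamp_itv p st; have /andP[sq qt] := clamp_itv q st.
    rewrite ger0_norm ?subr_ge0; last exact: len_mono.
    by rewrite mul1r; apply: le_trans Hd; exact: len_lip.
  have fs : f s = 0 by rewrite /f clamp_id.
  have ft : f t = L by rewrite /f clamp_id.
  have [|u ust fu] := @IVT _ f s t w st (continuous_subspaceT fc).
    by rewrite fs ft (min_l L0) (max_r L0).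
  by move: ust; rewrite in_itv/= => /andP[su ut]; exists u; rewrite su ut -fu /f clamp_id.
(* Only the lengths are ordered: if [v] precedes [u], the lengths agree and so do the points. *)
have enorm_c u v : s <= u <= t -> s <= v <= t -> len u <= len v ->
    enorm (g u - g v) <= len v - len u.
  move=> /andP[su ut] /andP[sv vt] uv; case: (leP u v) => [|/ltW] vu; first exact: len_chord.
  have := len_chord v u sv vu ut; have := len_mono v u sv vu ut.
  rewrite enormC; lra.
split=> //; exists (g \o c); split.
- by move=> w; rewrite in_itv/= => /Hc[/andP[su ut] _]; exact: gS.
- apply/elipschitzE => p q p0 pq qL /=.
  have [|cp lp] := Hc p; first by rewrite p0 (le_trans pq).
  have [|cq lq] := Hc q; first by rewrite qL (le_trans p0).
  by rewrite mul1r; have := enorm_c _ _ cp cq; rewrite lp lq; exact.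
(* [c 0] need not be [s], but equal lengths give equal points; likewise for [c L] and [t]. *)
- have [|c0 l0] := Hc 0; first by rewrite lexx.
  apply: enorm_small => e e0 /=; apply: le_trans (ltW e0).
  have ss : s <= s <= t by rewrite lexx.
  by have := enorm_c _ _ ss c0; rewrite l0 len_s subrr enormC; apply.
- have [|c0 l0] := Hc L; first by rewrite lexx L0.
  apply: enorm_small => e e0 /=; apply: le_trans (ltW e0).
  have tt : s <= t <= t by rewrite lexx andbT.
  by have := enorm_c _ _ c0 tt; rewrite l0 lenL subrr; apply.
Qed.

Lemma shortest_path_exists S x y a : compact S -> intrinsic_dist S x y = a%:E ->
  exists2 g, shortest_path S x y a g & lip_on 1 0 a g.
Proof.
move=> cS dE; have [a0 [g [gS /elipschitzE gL gx gy]]] := reach_intrinsic_dist cS dE.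
have speed : unit_speed a g.
  move=> s t s0 st ta.
  have gLst : lip_on 1 s t g.
    by move=> p q sp pq qt; apply: gL => //; [exact: le_trans sp|exact: le_trans ta].
  have sub (p q : R) : 0 <= p -> p <= q -> q <= a -> reach S (q - p) (g p) (g q).
    move=> p0 pq qa; split; first by rewrite subr_ge0.
    exists (fun u => g (p + u)); split; rewrite ?addr0 ?subrKC//.
      move=> u; rewrite in_itv/= => /andP[u0 uq]; apply: gS.
      by rewrite in_itv/=; apply/andP; split; lra.
    apply/elipschitzE => u v u0 uv vq; have -> : v - u = p + v - (p + u) by ring.
    by apply: gL; lra.
  have [le_len len0] := (curve_length_lip gLst, curve_length_ge0 g st).
  have lenE : curve_length g s t = (fine (curve_length g s t))%:E.
    by rewrite fineK// ge0_fin_numE// (le_lt_trans le_len)// ltry.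
  have gSst u : s <= u -> u <= t -> S (g u).
    by move=> su ut; apply: gS; rewrite in_itv/=; apply/andP; split; lra.
  have := reach_curve_length st gSst gLst lenE; rewrite lenE in le_len *.
  move: (fine _) le_len => L; rewrite lee_fin /= => le_L HL.
  have sa : s <= a by lra.
  have t0 : 0 <= t by lra.
  (* Replacing the piece over [s, t] by its reparametrization takes time [s + L + (a - t)].
     Minimality of [a] forces [L >= t - s]. *)
  have := reach_trans (reach_trans (sub 0 s (lexx _) s0 sa) HL) (sub t a t0 ta (lexx _)).
  rewrite gx gy => /intrinsic_dist_le; rewrite dE lee_fin => H.
  by congr EFin; lra.
exists g => //; split; first by split.
split; last by rewrite dE ltry.
by rewrite speed// subr0 dE.
Qed.

End Length.

(** * Curvature and chords *)

Section Curvature.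
Variables (R : realType) (D : nat) (a : R) (g dg : R -> 'rV[R]_D).
Hypotheses (gL : lip_on 1 0 a g) (dgP : derivative_on a g dg).
Implicit Types (s t p q k e : R) (v : 'rV[R]_D).

Lemma derivative_on_near t e : 0 <= t -> t <= a -> 0 < e ->
  exists2 d, 0 < d & forall s, 0 <= s -> s <= a -> s != t -> `|s - t| < d ->
    enorm ((s - t)^-1 *: (g s - g t) - dg t) < e.
Proof.
move=> t0 ta e0.
have tP : t \in `[0, a] by rewrite in_itv/= t0.
have := dgP tP (nbhs_enorm (dg t) e0); rewrite /fmap /within /= /dnbhs /within /=.
move=> /nbhs_ballP[d /= d0 H]; exists d => // s s0 sa st sd; apply: H => //=.
- by rewrite -ball_normE/= distrC.
- by rewrite in_itv/= s0.
Qed.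

(** A scalar component of the curve: the mean value theorem holds for it, though not for
    vector-valued [g]. *)
Let gc v s := edot (g (clamp 0 a s)) v.

Let gc_continuous v : 0 <= a -> continuous (gc v).
Proof.
move=> a0; apply: (@continuous_lip _ (enorm v)) => s t st.
have [H1 H2] := clamp_dist a0 st.
have /andP[s0 sa] := clamp_itv s a0; have /andP[t0 ta] := clamp_itv t a0.
rewrite /gc -edotBl; apply: (le_trans (edot_abs_le _ _)); rewrite mulrC.
apply: ler_wpM2l; first exact: enorm_ge0.
rewrite enormC; have := gL s0 H1 ta; lra.
Qed.

Let is_derive_gc v t : 0 < t -> t < a -> is_derive t 1 (gc v) (edot (dg t) v).
Proof.
move=> t0 ta.
have cv : h^-1 *: ((gc v \o shift t) (h *: 1) - gc v t) @[h --> 0^'] --> edot (dg t) v.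
  apply/cvgrPdist_lt => e e0.
  have v1 : 0 < enorm v + 1 by rewrite ltr_wpDl ?enorm_ge0.
  have [d d0 Hd] := derivative_on_near (ltW t0) (ltW ta) (divr_gt0 e0 v1).
  near=> h.
  have hd : `|h| < d by near: h; exact: dnbhs0_lt.
  have ht : `|h| < t by near: h; exact: dnbhs0_lt.
  have hat : `|h| < a - t by near: h; apply: dnbhs0_lt; rewrite subr_gt0.
  have h0 : h != 0 by near: h; exact: nbhs_dnbhs_neq.
  have {ht} ht0 : 0 <= h + t by move: ht; rewrite ltr_norml => /andP[]; lra.
  have {hat} hta : h + t <= a by move: hat; rewrite ltr_norml => /andP[]; lra.
  have := Hd _ ht0 hta; rewrite addrK => /(_ _ hd).
  rewrite -subr_eq0 addrK => /(_ h0).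
  rewrite ltr_pdivlMr// => /(le_lt_trans _); apply.
  rewrite /gc /= [h *: 1]mulr1 (clamp_id ht0 hta) (clamp_id (ltW t0) (ltW ta)).
  rewrite -edotBl -[_ *: _]/(_ * _) -edotZl -edotBl.
  apply: (le_trans (edot_abs_le _ _)); rewrite enormC; apply: ler_wpM2l; first exact: enorm_ge0.
  by rewrite lerDl.
apply: DeriveDef; first by apply/cvg_ex; exists (edot (dg t) v).
by apply: cvg_lim.
Unshelve. all: end_near. Qed.

(** The mean value theorem for the pairing of [g] with [v], minus [f]. Taking [f = 0] bounds the
    speed of [g]; taking [f] cubic replaces an integration in the chord bound. *)
Lemma derivative_on_edot_mvt v (f df : R -> R) p q : 0 <= p -> p < q -> q <= a ->
  (forall t, is_derive t 1 f (df t)) ->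
  exists c, [/\ p < c, c < q &
    edot (g q) v - edot (g p) v = f q - f p + (edot (dg c) v - df c) * (q - p)].
Proof.
move=> p0 pq qa fD.
have a0 : 0 <= a by lra.
have fc : continuous f.
  by move=> t; apply: differentiable_continuous; apply/derivable1_diffP; case: (fD t).
have [||c] := @MVT _ (gc v - f) (fun t => edot (dg t) v - df t) _ _ pq.
- move=> t; rewrite in_itv/= => /andP[pt tq].
  by apply: is_deriveB; apply: is_derive_gc; lra.
- apply: continuous_subspaceT => t; apply: continuousB; [exact: gc_continuous|exact: fc].
- rewrite in_itv/= => /andP[pc cq]; rewrite /gc !fctE !clamp_id; try lra.
  by move=> H; exists c; split => //; lra.
Qed.

(** Pairing with the chord [w] itself reduces the claim to the scalar case; a factor [enorm w] then
    cancels. *)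
Lemma derivative_on_mvt_le k p q : 0 <= p -> p <= q -> q <= a ->
  (forall t, p <= t -> t <= q -> enorm (dg t) <= k) -> lip_on k p q g.
Proof.
move=> p0 _ qa dgk s t ps; rewrite le_eqVlt => /predU1P[->|st] tq.
  by rewrite !subrr enorm0 mulr0.
have s0 : 0 <= s by lra.
have ta : t <= a by lra.
pose w := g t - g s.
have [c [sc ct]] := derivative_on_edot_mvt w s0 st ta (fun t => is_derive_cst (0 : R) t 1).
rewrite -edotBl subrr add0r subr0 -enorm_sqr => H.
have := edot_le_enorm (dg c) w; have := dgk c.
rewrite enormC -/w => /(_ _ _)/[swap] le_w Hk.
have {}Hk : enorm (dg c) <= k by apply: Hk; lra.
have w0 := enorm_ge0 w.
have {}le_w : edot (dg c) w <= k * enorm w by apply: (le_trans le_w); exact: ler_wpM2r.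
have : enorm w * enorm w <= (k * (t - s)) * enorm w by rewrite -expr2 H; nra.
move: w0; rewrite le_eqVlt => /predU1P[<- _|w0]; last by rewrite ler_pM2r.
have := enorm_ge0 (dg c); nra.
Qed.

Lemma enorm_derivative_le1 t : 0 < t -> t < a -> enorm (dg t) <= 1.
Proof.
move=> t0 ta; apply/ler_addgt0Pr => e e0.
have [d d0 Hd] := derivative_on_near (ltW t0) (ltW ta) e0.
pose h := Num.min (d / 2) (a - t).
have h0 : 0 < h by rewrite lt_min divr_gt0//= subr_gt0.
have hd : h <= d / 2 by rewrite ge_min lexx.
have ha : h <= a - t by rewrite ge_min lexx orbT.
have ht : t <= t + h by lra.
have hta : t + h <= a by lra.
have := Hd (t + h); rewrite (addrC t) addrK -subr_eq0 addrK gtr0_norm// gt_eqF//.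
rewrite addrC => /(_ _ _ isT _) Hh.
have {}Hh : enorm (h^-1 *: (g (t + h) - g t) - dg t) < e by apply: Hh; lra.
have := gL (ltW t0) ht hta; rewrite enormC => gh.
have : enorm (h^-1 *: (g (t + h) - g t)) <= 1.
  by rewrite enormZ gtr0_norm ?invr_gt0// ler_pdivrMl// mulr1; lra.
have := enorm_triangle (h^-1 *: (g (t + h) - g t)) (dg t) 0.
rewrite !subr0 enormC; lra.
Qed.

(** If [n < 1], the speed stays at most [(1 + n) / 2 < 1] around [t] because [dg] is Lipschitz, and
    the length of that piece falls short of its duration. *)
Lemma enorm_derivative_ge1 kappa t : 0 < kappa -> elipschitz kappa a dg ->
  unit_speed a g -> 0 < t -> t < a -> 1 <= enorm (dg t).
Proof.
move=> k0 /elipschitzE dgL gU t0 ta; rewrite leNgt; apply/negP => n1.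
set n := enorm (dg t) in n1.
(* Within [h] of [t] the derivative changes by at most [kappa * h], half the gap [1 - n]; the other
   two terms keep the window inside [0, a]. *)
pose h := Num.min ((1 - n) / (2 * kappa)) (Num.min t (a - t)).
have h0 : 0 < h by rewrite !lt_min t0 subr_gt0 ta divr_gt0// ?subr_gt0// mulr_gt0.
have hk : kappa * h <= (1 - n) / 2.
  have : h <= (1 - n) / (2 * kappa) by rewrite ge_min lexx.
  by rewrite ler_pdivlMr ?mulr_gt0//; lra.
have [ht ha] : h <= t /\ h <= a - t by split; rewrite !ge_min lexx !orbT.
have lip : lip_on ((1 + n) / 2) (t - h) (t + h) g.
  apply: derivative_on_mvt_le; [lra|lra|lra|] => s s1 s2.
  have := enorm_triangle (dg t) (dg s) 0; rewrite !subr0 -/n.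
  case: (leP s t) => st.
    have := @dgL s t; move=> /(_ _ st _) H.
    have {}H : enorm (dg s - dg t) <= kappa * (t - s) by apply: H; lra.
    nra.
  have := @dgL t s; move=> /(_ _ (ltW st) _) H.
  have {}H : enorm (dg t - dg s) <= kappa * (s - t) by apply: H; lra.
  rewrite (enormC (dg s) (dg t)); nra.
have := curve_length_lip lip; rewrite gU ?lee_fin; [|lra|lra|lra].
nra.
Qed.

(* Pairing [g] with its velocity at the midpoint [m]: the identity
   [2 <u, v> = |u|^2 + |v|^2 - |u - v|^2] gives
   [<g' s, g' m> >= 1 - kappa^2 (s - m)^2 / 2], to be integrated over [0, a]. *)
Lemma chord_lower_bound kappa : 0 < kappa -> 0 < a -> elipschitz kappa a dg ->
  unit_speed a g -> a - kappa ^+ 2 * a ^+ 3 / 24 <= enorm (g a - g 0).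
Proof.
move=> k0 a0 dgL gU.
pose m := a / 2; have m0 : 0 < m by rewrite divr_gt0.
have ma : m < a by rewrite /m; lra.
(* An antiderivative of the lower bound [df], with [f a - f 0 = a - kappa^2 a^3 / 24]. *)
pose f s := s - kappa ^+ 2 / 6 * (s - m) ^+ 3.
pose df s := 1 - kappa ^+ 2 / 2 * (s - m) ^+ 2.
have fD s : is_derive s 1 f (df s).
  rewrite /f; apply: is_derive_eq; rewrite /df /GRing.scale/=; lra.
have [c [c0 ca]] := derivative_on_edot_mvt (dg m) (lexx 0) a0 (lexx a) fD.
rewrite -edotBl subr0 => H.
have := edot_le_enorm (g a - g 0) (dg m); rewrite H.
have le1 := enorm_derivative_le1 m0 ma; have ga := enorm_ge0 (g a - g 0).
have gec := enorm_derivative_ge1 k0 dgL gU c0 ca.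
have gem := enorm_derivative_ge1 k0 dgL gU m0 ma.
have dle : df c <= edot (dg c) (dg m).
  have : enorm (dg c - dg m) ^+ 2 <= (kappa * `|c - m|) ^+ 2.
    have k0' := ltW k0; rewrite ler_pXn2r ?nnegrE ?mulr_ge0 ?enorm_ge0//.
    by apply: dgL; rewrite in_itv/= !ltW.
  rewrite exprMn real_normK ?num_real// enorm_sqr edotBr !edotBl -!enorm_sqr (edotC (dg m)) /df.
  nra.
have := mulr_ge0 (ltW a0) (_ : 0 <= edot (dg c) (dg m) - df c); rewrite subr_ge0 => /(_ dle).
have : enorm (g a - g 0) * enorm (dg m) <= enorm (g a - g 0) by rewrite ler_piMr.
rewrite /f /m; lra.
Qed.

End Curvature.

(** * Comparison of the two distances *)

Section Main.
Variables (R : realType) (D : nat).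
Implicit Types (S : set 'rV[R]_D) (x y z : 'rV[R]_D) (kappa e r tau : R).

Lemma intrinsic_dist_sym S x y : intrinsic_dist S x y = intrinsic_dist S y x.
Proof.
by apply/le_anti/andP; split; apply: le_intrinsic_dist => a /reach_sym; exact: intrinsic_dist_le.
Qed.

Lemma intrinsic_dist_refl S x : S x -> intrinsic_dist S x x = 0%E.
Proof.
move=> Sx; apply/le_anti/andP; split; last exact: intrinsic_dist_ge0.
exact: intrinsic_dist_le (reach_refl Sx).
Qed.

Lemma enorm_le_intrinsic_dist S x y : ((enorm (x - y))%:E <= intrinsic_dist S x y)%E.
Proof. by apply: le_intrinsic_dist => a /enorm_le_reach; rewrite lee_fin. Qed.

Lemma intrinsic_open_ball S z e :
  intrinsic_open S [set y | S y /\ (intrinsic_dist S z y < e%:E)%E].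
Proof.
split=> [y []//|y [Sy zy]].
have fin_zy : intrinsic_dist S z y \is a fin_num.
  by rewrite ge0_fin_numE ?intrinsic_dist_ge0// (lt_trans zy)// ltry.
exists (e - fine (intrinsic_dist S z y)).
  by rewrite subr_gt0 -lte_fin fineK.
move=> w Sw yw; split=> //; apply: le_lt_trans (intrinsic_dist_triangle _ _ y _) _.
by move: yw; rewrite -(fineK fin_zy) EFinB fineK// lteBrDl// -(fineK fin_zy).
Qed.

(** A Lebesgue number argument: around each [z] the intrinsic ball of radius [e / 2] contains the
    trace of an ambient ball, and compactness makes the radius uniform. *)
Lemma intrinsic_dist_unif S : compact S -> same_topology S ->
  forall e, 0 < e -> exists2 d, 0 < d & forall x y, S x -> S y ->
    enorm (x - y) <= d -> (intrinsic_dist S x y < e%:E)%E.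
Proof.
move=> /compact_near_coveringP cS topS e e0.
pose P d x := S x -> forall y, S y -> enorm (x - y) <= d -> (intrinsic_dist S x y < e%:E)%E.
have e20 : 0 < e / 2 by exact: divr_gt0.
have [|d dP] := @filter_ex R 0^'+ _ (fun d => 0 < d /\ S `<=` P d).
  near=> d; split; first by near: d; exact: nbhs_right_gt.
  near: d; apply: cS => z Sz.
  have /topS[V oV VE] := intrinsic_open_ball S z (e / 2).
  have Vz : V z.
    suff : (V `&` S) z by case.
    by rewrite -VE /= intrinsic_dist_refl// lte_fin.
  have /nbhs_ballP[p /= p0 pV] := open_nbhs_nbhs (conj oV Vz).
  have p20 : 0 < p / 2 by exact: divr_gt0.
  have ball_lt x : S x -> ball z p x -> (intrinsic_dist S z x < (e / 2)%:E)%E.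
    move=> Sx /pV Vx; suff : (V `&` S) x by rewrite -VE => -[].
    by split.
  (* Halving [p] puts both [x] and any [y] within [d] of it into [ball z p]. *)
  exists (ball z (p / 2), [set d | d < p / 2]) => /=.
    by split; [exact: nbhsx_ballx|exact: nbhs_right_lt].
  move=> [x d] /= [zx dp] Sx y Sy xyd.
  have xy : ball x (p / 2) y.
    rewrite -ball_normE/=; apply: le_lt_trans (mx_norm_le_enorm _) _.
    exact: le_lt_trans xyd dp.
  have p2p : p / 2 <= p by lra.
  have zxe := ball_lt x Sx (le_ball p2p zx).
  have zye := ball_lt y Sy (ball_split zx xy).
  apply: le_lt_trans (intrinsic_dist_triangle _ _ z _) _.
  by rewrite [e in e%:E]splitr EFinD; apply: lteD; rewrite // intrinsic_dist_sym.
by exists d => [|x y Sx Sy]; [case: dP|exact: dP.2].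
Unshelve. all: end_near. Qed.

(** The cosine vanishes at [pi / 2] but not at 1. Strictness will make [rho] positive. *)
Lemma pihalf_gt1 : 1 < (pi : R) / 2.
Proof.
rewrite lt_neqAle pihalf_ge1 andbT; apply/eqP => pi1.
have [_] := pihalf_02_cos_pihalf R; rewrite -pi1 => cos0.
by have := cos1_gt0 R; rewrite cos0 ltxx.
Qed.

Lemma c0_ge0 : 0 <= (c0 : R).
Proof. by rewrite divr_ge0 ?sqr_ge0. Qed.

Lemma c0M_ge0 kappa r : 0 <= c0 * kappa ^+ 2 * r ^+ 2.
Proof. exact: mulr_ge0 (mulr_ge0 c0_ge0 (sqr_ge0 _)) (sqr_ge0 _). Qed.

Lemma metric_comparison_exists S kappa : 0 < kappa -> compact S -> same_topology S ->
  (forall x x' a g, shortest_path S x x' a g -> curvature_bounded kappa a g) ->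
  exists2 tau, 0 < tau & metric_comparison S kappa tau.
Proof.
move=> k0 cS topS curvS.
pose p := (pi : R) / 2; have p1 : 1 < p by exact: pihalf_gt1.
have p2 : p < 2 by exact: pihalf_lt2.
(* From [kappa * a < rho < 1] follows [t = (kappa * a)^2 <= rho]. Then [t < 1] serves the quadratic
   bound, and [(1 - t / 24) (1 + rho) >= 1] serves the bound by [pi / 2]. *)
pose rho := p - 1; have rho0 : 0 < rho by rewrite subr_gt0.
have [tau tau0 tauP] := intrinsic_dist_unif cS topS (divr_gt0 rho0 k0).
exists tau => // x y Sx Sy xy; split; first exact: enorm_le_intrinsic_dist.
have lt_xy := tauP x y Sx Sy xy.
have fin_xy : intrinsic_dist S x y \is a fin_num.
  by rewrite ge0_fin_numE ?intrinsic_dist_ge0// (lt_trans lt_xy)// ltry.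
move: lt_xy (fineK fin_xy); move: (fine _) => a /[swap] /esym dE.
have := intrinsic_dist_ge0 S x y; rewrite dE !lte_fin !lee_fin => a0.
rewrite ltr_pdivlMr// mulrC => ka.
have [g gP gL] := shortest_path_exists cS dE.
have [[_ _ gU gx gy] _] := gP.
have [dg dgP dgL] := curvS _ _ _ _ gP.
(* Written in [p], so that [p > 1] yields the rational lower bound [2 / 25]. *)
have c0E : c0 = 2 * p ^+ 2 / 25 :> R by rewrite /c0 /p; field.
set d := enorm (x - y); have d0 : 0 <= d by exact: enorm_ge0.
have min1 : 1 <= Num.min (pi / 2) (1 + c0 * kappa ^+ 2 * d ^+ 2).
  by rewrite le_min pihalf_ge1 lerDl c0M_ge0.
move: a0; rewrite le_eqVlt => /predU1P[<-|a0]; first by rewrite mulr_ge0 ?(le_trans ler01 min1).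
have := chord_lower_bound gL dgP k0 a0 dgL gU; rewrite gx gy enormC -/d.
pose t := (kappa * a) ^+ 2.
have t0 : 0 <= t by exact: sqr_ge0.
have trho : t <= rho.
  have ka0 : 0 < kappa * a by exact: mulr_gt0.
  by rewrite /t /rho in ka *; nra.
have -> : a - kappa ^+ 2 * a ^+ 3 / 24 = a * (1 - t / 24) by rewrite /t; field.
move=> le_d; have q0 : 23 / 24 <= 1 - t / 24 by rewrite /rho in trho; lra.
have aq : 23 / 24 * a <= d by apply: le_trans le_d; rewrite mulrC ler_pM2l.
rewrite minr_pMr//; rewrite le_min; apply/andP; split.
  rewrite -/p; apply: (@le_trans _ _ (a * (1 - t / 24) * p)); last first.
    by apply: ler_wpM2r => //; lra.
  rewrite -mulrA ler_peMr ?(ltW a0)//.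
  by rewrite /rho in trho *; nra.
have c0_lb : 2 / 25 <= (c0 : R) by rewrite c0E; nra.
(* The crude bound [d >= 23 a / 24] trades [a] in [t] for [d], in which the goal is stated. *)
have sq : (23 / 24) ^+ 2 * t <= kappa ^+ 2 * d ^+ 2.
  have [k0' a0'] := (ltW k0, ltW a0).
  by rewrite /t -!exprMn ler_pXn2r ?nnegrE ?mulr_ge0// mulrCA ler_pM2l.
(* [18 / 250] lies below [(2 / 25) (23 / 24)^2] and above [(1 / 24) (24 / 23)]. *)
have le_c : t * (18 / 250) <= c0 * kappa ^+ 2 * d ^+ 2.
  rewrite -mulrA; set Q := _ * d ^+ 2 in sq *.
  by apply: (@le_trans _ _ (2 / 25 * Q)); [lra|apply: ler_wpM2r => //; lra].
apply: (@le_trans _ _ (a * (1 - t / 24) * (1 + t * (18 / 250)))).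
  rewrite -mulrA ler_peMr ?(ltW a0)//.
  by rewrite /rho in trho; nra.
apply: ler_pM => //; last by rewrite lerD2l.
- by rewrite mulr_ge0 ?(ltW a0)//; lra.
- by lra.
Qed.

(** Induction on the number [m] of edges. A non-edge makes the right side infinite; an edge has
    length at most [r <= tau], so [metric_comparison] applies and its factor is at most the uniform
    one. *)
Lemma walk_bound S kappa tau r N (x : 'I_N -> 'rV[R]_D) (k : nat -> 'I_N) m :
  metric_comparison S kappa tau -> (forall i, S (x i)) -> r <= tau ->
  (intrinsic_dist S (x (k 1%N)) (x (k m.+1)) <=
    (1 + c0 * kappa ^+ 2 * r ^+ 2)%:E *
    \sum_(1 <= l < m.+1) ball_graph_weight x r (k l) (k l.+1))%E.
Proof.
move=> mS xS rtau; set C := 1 + _.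
have C1 : 1 <= C by rewrite lerDl c0M_ge0.
have C0 : 0 < C by exact: lt_le_trans C1.
have w0 i j : (0 <= ball_graph_weight x r i j)%E.
  by rewrite /ball_graph_weight; case: ifP => // _; rewrite lee_fin enorm_ge0.
elim: m => [|m IHm]; first by rewrite big_geq// mule0 intrinsic_dist_refl.
rewrite big_nat_recr//= ge0_muleDr//; last exact: sume_ge0.
apply: le_trans (intrinsic_dist_triangle _ _ (x (k m.+1)) _) _.
apply: leeD => //; rewrite /ball_graph_weight; case: ifPn => [xr|_]; last first.
  by rewrite gt0_muley ?leey.
have [_ /le_trans] := mS _ _ (xS (k m.+1)) (xS (k m.+2)) (le_trans xr rtau).
apply; rewrite -EFinM lee_fin mulrC; apply: ler_wpM2r; first exact: enorm_ge0.
(* Only the quadratic term of the minimum enters the final bound. *)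
rewrite ge_min; apply/orP; right; rewrite lerD2l; apply: ler_wpM2l.
  by rewrite mulr_ge0 ?c0_ge0 ?sqr_ge0.
by rewrite ler_pXn2r ?nnegrE ?enorm_ge0// (le_trans _ xr) ?enorm_ge0.
Qed.

End Main.

Unset Implicit Arguments.
Set Strict Implicit.
Set Printing Implicit Defensive.

Theorem proposition2 (R : realType) (D : nat) (S : set 'rV[R]_D) (kappa : R)
    (kappa_gt0 : 0 < kappa)
    (compactS : compact S)
    (topS : same_topology S)
    (curvS : forall (x x' : 'rV[R]_D) (a : R) (g : R -> 'rV[R]_D),
       shortest_path S x x' a g -> curvature_bounded kappa a g) :
  (exists2 tau : R, 0 < tau & metric_comparison S kappa tau) /\
  (forall tau : R, 0 < tau -> metric_comparison S kappa tau ->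
   forall (N : nat) (x : 'I_N -> 'rV[R]_D), (forall i, S (x i)) ->
   forall r : R, 0 < r -> r <= tau -> kappa * r <= 1 / 3 ->
   forall i j : 'I_N,
     (intrinsic_dist S (x i) (x j) <=
       (1 + c0 * kappa ^+ 2 * r ^+ 2)%:E * graph_dist x r i j)%E).
Proof.
split; first exact: metric_comparison_exists.
move=> tau _ mS N x xS r _ rtau _ i j.
have C0 : 0 < 1 + c0 * kappa ^+ 2 * r ^+ 2.
  by rewrite ltr_wpDr// c0M_ge0.
(* Dividing by the positive constant isolates the infimum, so that each walk can be bounded
   separately. *)
rewrite -lee_pdivrMl//; apply: le_ereal_inf_tmp => _ [m [k [+ <- <- ->]]]; case: m => // m _.
by rewrite lee_pdivrMl//; exact: (walk_bound k m mS xS rtau).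
Qed.
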